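(* Let $\mathcal{M}$ be a multicategory. The rewrite relation $\to$ on the terms $T(\mathcal{M})$ is terminating, i.e. there is no infinite sequence $t_0 \to t_1 \to t_2 \to \cdots$ of terms of $T(\mathcal{M})$.
   Context: **Multicategory notation.** Fix a multicategory $\mathcal{M}$ with set of objects $\mathcal{M}_0$. Morphisms are written in sequent notation: $x_1{:}A_1,\ldots,x_n{:}A_n \vdash v : A$ ($n \ge 0$, distinct variables) denotes a morphism $v \in \mathcal{M}(A_1,\ldots,A_n;A)$; $x{:}A \vdash x : A$ denotes the identity, and for $\Gamma_i \vdash v_i : A_i$ the substitution $v[v_1,\ldots,v_n/x_1,\ldots,x_n]$ denotes the composite $v \circ (v_1,\ldots,v_n)$; expressions denoting the same morphism of $\mathcal{M}$ are identified. Contexts $\Gamma$ are ordered lists of typed variables without repeated variables. $\mathcal{M}_0^{\circ\bullet} = (\mathcal{M}_0 \times \{\circ,\bullet\})^*$ is the free monoid on polarised objects $A^\circ, A^\bullet$, with empty word $\lambda$ (also written $I$). **Terms.** $T(\mathcal{M})$ consists of the terms $t$ with $\Gamma \Vdash t : (U,B,W)$ (where $U,W \in \mathcal{M}_0^{\circ\bullet}$, $B \in \mathcal{M}_0$) derivable by the following rules (bound variables may be renamed): - (seq) if $\Gamma \vdash v : A$ then $\Gamma \Vdash [v] : (\lambda,A,\lambda)$; - (let) if $n \ge 1$, $\Gamma_i \Vdash t_i : (U_{i-1},A_i,U_i)$ for $1 \le i \le n$, and $x_1{:}A_1,\ldots,x_n{:}A_n \Vdash t : (V,B,W)$, then $\Gamma_1,\ldots,\Gamma_n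 \Vdash \mathsf{let}\ x_1,\ldots,x_n \downarrow (t_1 \mid \cdots \mid t_n)\ \mathsf{in}\ t : (U_0V,B,U_nW)$; - (putR) if $\Delta \Vdash t : (U,B,W)$ and $\Gamma \vdash v : A$ then $\Delta,\Gamma \Vdash \mathsf{putR}(v,t) : (U,B,A^\circ W)$; - (getL) if $x{:}A,\Gamma \Vdash t : (U,B,W)$ then $\Gamma \Vdash \mathsf{getL}(x.t) : (A^\circ U,B,W)$; - (getR) if $\Gamma,x{:}A \Vdash t : (U,B,W)$ then $\Gamma \Vdash \mathsf{getR}(x.t) : (U,B,A^\bullet W)$; - (putL) if $\Gamma \vdash v : A$ and $\Delta \Vdash t : (U,B,W)$ then $\Gamma,\Delta \Vdash \mathsf{putL}(v,t) : (A^\bullet U,B,W)$. **Value substitution.** For $\Gamma_i \vdash v_i : A_i$ ($1\le i\le n$) and $x_1{:}A_1,\ldots,x_n{:}A_n \Vdash t : (U,B,W)$, the term $\Gamma_1,\ldots,\Gamma_n \Vdash t[\overline v/\overline x] : (U,B,W)$ is defined by recursion: $[u][\overline v/\overline x] = [u[\overline v/\overline x]]$; $\mathsf{putR}(u,s)[\overline v/\overline x] = \mathsf{putR}(u[\overline{v_2}/\overline{x_2}],s[\overline{v_1}/\overline{x_1}])$ and $\mathsf{putL}(u,s)[\overline v/\overline x] = \mathsf{putL}(u[\overline{v_1}/\overline{x_1}],s[\overline{v_2}/\overline{x_2}])$, where $\overline x = \overline{x_1},\overline{x_2}$ is split as dictated by the typing rule (and $\overline v$ accordingly); $\mathsf{getL}(y.s)[\overline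 v/\overline x] = \mathsf{getL}(y.s[\overline v/\overline x])$ and $\mathsf{getR}(y.s)[\overline v/\overline x] = \mathsf{getR}(y.s[\overline v/\overline x])$ ($y$ being substituted for itself); $(\mathsf{let}\ \overline y \downarrow (t_1 \mid \cdots \mid t_m)\ \mathsf{in}\ s)[\overline v/\overline x] = \mathsf{let}\ \overline y \downarrow (t_1[\overline{v_1}/\overline{x_1}] \mid \cdots \mid t_m[\overline{v_m}/\overline{x_m}])\ \mathsf{in}\ s$ with $\overline x$ split into the contexts $\overline{x_j}$ of the $t_j$. Variables substituted for themselves may be omitted, as in $t[v/y]$. **Rewriting.** $\to$ is the least relation on terms closed under all term formers (i.e. under rewriting subterms) containing (where $\overline a,\overline b$ are possibly empty sequences of terms): - [R0] $\mathsf{let}\ x_1,\ldots,x_n \downarrow ([v_1] \mid \cdots \mid [v_n])\ \mathsf{in}\ t \to t[v_1,\ldots,v_n/x_1,\ldots,x_n]$ - [R1] $\mathsf{let}\ \overline x \downarrow (\overline a \mid \mathsf{putR}(v,t) \mid \mathsf{getL}(y.s) \mid \overline b)\ \mathsf{in}\ r \to \mathsf{let}\ \overline x \downarrow (\overline a \mid t \mid s[v/y] \mid \overline b)\ \mathsf{in}\ r$ - [R2] $\mathsf{let}\ \overline x \downarrow (\overline a \mid \mathsf{getR}(y.t) \mid \mathsf{putL}(v,s) \mid \overline b)\ \mathsf{in}\ r \to \mathsf{let}\ \overline x \downarrow (\overline a \mid t[v/y] \mid s \mid \overline b)\ \mathsf{in}\ r$ - [R3] $\mathsf{let}\ \overline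 x \downarrow (\mathsf{putL}(v,t) \mid \overline a)\ \mathsf{in}\ r \to \mathsf{putL}(v,\mathsf{let}\ \overline x \downarrow (t \mid \overline a)\ \mathsf{in}\ r)$ - [R4] $\mathsf{let}\ \overline x \downarrow (\mathsf{getL}(y.t) \mid \overline a)\ \mathsf{in}\ r \to \mathsf{getL}(y.\mathsf{let}\ \overline x \downarrow (t \mid \overline a)\ \mathsf{in}\ r)$ - [R5] $\mathsf{let}\ \overline x \downarrow (\overline a \mid \mathsf{putR}(v,t))\ \mathsf{in}\ r \to \mathsf{putR}(v,\mathsf{let}\ \overline x \downarrow (\overline a \mid t)\ \mathsf{in}\ r)$ - [R6] $\mathsf{let}\ \overline x \downarrow (\overline a \mid \mathsf{getR}(y.t))\ \mathsf{in}\ r \to \mathsf{getR}(y.\mathsf{let}\ \overline x \downarrow (\overline a \mid t)\ \mathsf{in}\ r)$ - [R7] $\mathsf{putR}(v,\mathsf{putL}(w,t)) \to \mathsf{putL}(w,\mathsf{putR}(v,t))$ - [R8] $\mathsf{putR}(v,\mathsf{getL}(x.t)) \to \mathsf{getL}(x.\mathsf{putR}(v,t))$ when $x$ does not occur in $v$ - [R9] $\mathsf{getR}(x.\mathsf{putL}(v,t)) \to \mathsf{putL}(v,\mathsf{getR}(x.t))$ when $x$ does not occur in $v$ - [R10] $\mathsf{getR}(x.\mathsf{getL}(y.t)) \to \mathsf{getL}(y.\mathsf{getR}(x.t))$ *)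

(* Defs.v *)
From mathcomp Require Import all_boot.

Set Implicit Arguments.
Unset Strict Implicit.
Unset Printing Implicit Defensive.

(* Contexts are ordered and linear, so a variable is determined by its position:
   a context is the list of its types, and terms are taken up to renaming of
   all variables.  A context in the conclusion of a typing rule that is a
   concatenation is a variable [Th] constrained by an equation [Th = G ++ D];
   this makes the rules that reassociate contexts well typed without casts.
   These equations carry no information: wherever terms are rewritten, they are
   quantified over arbitrary proofs. *)

Section Tuples.
Variables (O : Type) (hom : seq O -> O -> Type).

(* [vals Th [:: A1; ...; An]] is the type of tuples (v1, ..., vn) with
   vi : hom Gi Ai and Th = G1 ++ ... ++ Gn. *)
Inductive vals : seq O -> seq O -> Type :=
| vnil : vals [::] [::]
| vcons Th G D A As (e : Th = G ++ D) (v : hom G A) (vs : vals D As) :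
    vals Th (A :: As).

Record vcell (Th : seq O) (A : O) (As : seq O) : Type := VCell {
  vc_head : seq O;
  vc_tail : seq O;
  vc_eq : Th = vc_head ++ vc_tail;
  vc_val : hom vc_head A;
  vc_vals : vals vc_tail As }.

Definition vcases (Th As : seq O) : Type :=
  match As with [::] => Th = [::] | A :: As' => vcell Th A As' end.

Definition vcase Th As (vs : vals Th As) : vcases Th As :=
  match vs in vals Th0 As0 return vcases Th0 As0 with
  | vnil => erefl
  | vcons _ _ _ _ _ e v vs' => VCell e v vs'
  end.

Record vals2 (Th As Bs : seq O) : Type := Vals2 {
  v2_left : seq O;
  v2_right : seq O;
  v2_eq : Th = v2_left ++ v2_right;
  v2_fst : vals v2_left As;
  v2_snd : vals v2_right Bs }.

Lemma split_ctx (Th G D D1 D2 : seq O) :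
  Th = G ++ D -> D = D1 ++ D2 -> Th = (G ++ D1) ++ D2.
Proof. by move=> -> ->; rewrite catA. Qed.

Lemma cat_ctx (Th G D D' : seq O) :
  Th = G ++ D -> Th ++ D' = G ++ (D ++ D').
Proof. by move=> ->; rewrite catA. Qed.

Fixpoint vsplit_cat (As Bs Th : seq O) {struct As} :
    vals Th (As ++ Bs) -> vals2 Th As Bs :=
  match As return vals Th (As ++ Bs) -> vals2 Th As Bs with
  | [::] => fun vs => @Vals2 Th [::] Bs [::] Th erefl vnil vs
  | A :: As' => fun vs =>
      let: VCell _ _ e v vs' := vcase vs in
      let: Vals2 _ _ e' vs1 vs2 := vsplit_cat vs' in
      Vals2 (split_ctx e e') (vcons erefl v vs1) vs2
  end.

Definition vsplit (Cs As Bs Th : seq O) (e : Cs = As ++ Bs) (vs : vals Th Cs) :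
    vals2 Th As Bs :=
  vsplit_cat (eq_rect Cs (vals Th) vs (As ++ Bs) e).

Fixpoint vcat Th As (vs : vals Th As) Th' Bs (ws : vals Th' Bs) :
    vals (Th ++ Th') (As ++ Bs) :=
  match vs in vals Th0 As0 return vals (Th0 ++ Th') (As0 ++ Bs) with
  | vnil => ws
  | vcons _ _ _ _ _ e v vs' => vcons (cat_ctx Th' e) v (vcat vs' ws)
  end.

Definition vone G A (v : hom G A) : vals G [:: A] :=
  vcons (esym (cats0 G)) v vnil.

Fixpoint vid (idm : forall A, hom [:: A] A) (As : seq O) : vals As As :=
  match As with
  | [::] => vnil
  | A :: As' => @vcons (A :: As') [:: A] As' A As' erefl (idm A) (vid idm As')
  end.

(* (v1, ..., vn), (w1, ..., wm) |-> (v1 o ws1, ..., vn o wsn), where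
   ws1, ..., wsn is the splitting of w1, ..., wm along the sources of the vi. *)
Fixpoint vcomp
    (comp : forall G As B, hom As B -> vals G As -> hom G B)
    G As (vs : vals G As) : forall D, vals D G -> vals D As :=
  match vs in vals G0 As0 return forall D, vals D G0 -> vals D As0 with
  | vnil => fun D ws => ws
  | vcons _ _ _ _ _ e v vs' => fun D ws =>
      let: Vals2 _ _ e' ws1 ws2 := vsplit e ws in
      vcons e' (comp _ _ _ v ws1) (vcomp comp vs' ws2)
  end.

End Tuples.

Arguments vnil {O hom}.

Record multicategory : Type := Multicategory {
  ob : Type;
  hom : seq ob -> ob -> Type;
  idm : forall A, hom [:: A] A;
  comp : forall G As B, hom As B -> vals hom G As -> hom G B;
  comp_idr : forall As B (u : hom As B), comp u (vid idm As) = u;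
  comp_idl : forall G A (v : hom G A) (e : G = G ++ [::]),
    comp (idm A) (vcons e v vnil) = v;
  comp_assoc : forall D G As B
      (u : hom As B) (vs : vals hom G As) (ws : vals hom D G),
    comp (comp u vs) ws = comp u (vcomp comp vs ws) }.

Arguments hom {m}.
Arguments idm {m}.
Arguments comp {m G As B}.

(* [white] and [black] are the polarities written as a circle and a bullet. *)
Inductive polarity : Type := white | black.

Section Terms.
Variable M : multicategory.

Notation ctx := (seq (ob M)).
Notation word := (seq (ob M * polarity)).

(* [tms Th U [:: A1; ...; An] W] is the type of sequences (t1 | ... | tn) with
   ti : tm Gi U(i-1) Ai Ui, U0 = U, Un = W and Th = G1 ++ ... ++ Gn. *)
Inductive tm : ctx -> word -> ob M -> word -> Type :=
| Seq G A (v : hom G A) : tm G [::] A [::]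
| Let G As U U' V B W (n_ge1 : 1 <= size As)
    (ts : tms G U As U') (t : tm As V B W) : tm G (U ++ V) B (U' ++ W)
| PutR Th D G A U B W (e : Th = D ++ G)
    (v : hom G A) (t : tm D U B W) : tm Th U B ((A, white) :: W)
| GetL G A U B W (t : tm (A :: G) U B W) : tm G ((A, white) :: U) B W
| GetR G A U B W (t : tm (G ++ [:: A]) U B W) : tm G U B ((A, black) :: W)
| PutL Th G D A U B W (e : Th = G ++ D)
    (v : hom G A) (t : tm D U B W) : tm Th ((A, black) :: U) B W
with tms : ctx -> word -> seq (ob M) -> word -> Type :=
| TNil U : tms [::] U [::] U
| TCons Th G D A As U V W (e : Th = G ++ D)
    (t : tm G U A V) (ts : tms D V As W) : tms Th U (A :: As) W.

Fixpoint subst As U B W (t : tm As U B W) {struct t} :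
    forall Th, vals hom Th As -> tm Th U B W :=
  match t in tm As0 U0 B0 W0
    return forall Th, vals hom Th As0 -> tm Th U0 B0 W0
  with
  | Seq _ _ u => fun Th vs => Seq (comp u vs)
  | Let _ _ _ _ _ _ _ n_ge1 ts s => fun Th vs => Let n_ge1 (substs ts vs) s
  | PutR _ _ _ _ _ _ _ e u s => fun Th vs =>
      let: Vals2 _ _ e' vs1 vs2 := vsplit e vs in
      PutR e' (comp u vs2) (subst s vs1)
  | GetL _ A _ _ _ s => fun Th vs =>
      GetL (subst s
        (@vcons _ _ (A :: Th) [:: A] Th _ _ erefl (idm A) vs))
  | GetR _ A _ _ _ s => fun Th vs =>
      GetR (subst s (vcat vs (vone (idm A))))
  | PutL _ _ _ _ _ _ _ e u s => fun Th vs =>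
      let: Vals2 _ _ e' vs1 vs2 := vsplit e vs in
      PutL e' (comp u vs1) (subst s vs2)
  end
with substs Cs U As W (ts : tms Cs U As W) {struct ts} :
    forall Th, vals hom Th Cs -> tms Th U As W :=
  match ts in tms Cs0 U0 As0 W0
    return forall Th, vals hom Th Cs0 -> tms Th U0 As0 W0
  with
  | TNil U0 => fun Th vs =>
      eq_rect [::] (fun G => tms G U0 [::] U0) (TNil U0) Th (esym (vcase vs))
  | TCons _ _ _ _ _ _ _ _ e s ss => fun Th vs =>
      let: Vals2 _ _ e' vs1 vs2 := vsplit e vs in
      TCons e' (subst s vs1) (substs ss vs2)
  end.

(* Substitution of a value for the first, resp. last, variable. *)
Definition substl D A G U B W (v : hom D A) (t : tm (A :: G) U B W) :
    tm (D ++ G) U B W :=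
  subst t (vcons erefl v (vid idm G)).

Definition substr D A G U B W (v : hom D A) (t : tm (G ++ [:: A]) U B W) :
    tm (G ++ D) U B W :=
  subst t (vcat (vid idm G) (vone v)).

(* (v1, ..., vn) |-> ([v1] | ... | [vn]) *)
Fixpoint Seqs Th As (vs : vals hom Th As) : tms Th [::] As [::] :=
  match vs in vals _ Th0 As0 return tms Th0 [::] As0 [::] with
  | vnil => TNil [::]
  | vcons _ _ _ _ _ e v vs' => TCons e (Seq v) (Seqs vs')
  end.

(* [trcons a t c] holds when c is the sequence (a | t).  It is a relation
   rather than a function so that the equations stored in c are arbitrary. *)
Inductive trcons : forall D G Th U As V A W,
    tms D U As V -> tm G V A W -> tms Th U (As ++ [:: A]) W -> Prop :=
| trcons_nil G Th U A W (e : Th = G ++ [::]) (t : tm G U A W) :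
    trcons (TNil U) t (TCons e t (TNil W))
| trcons_cons C D D' G Th Th' U A0 As V V' A W
    (e : Th = C ++ D) (e' : Th' = C ++ D') (s : tm C U A0 V)
    (a : tms D V As V') (t : tm G V' A W) (c : tms D' V (As ++ [:: A]) W) :
    trcons a t c -> trcons (TCons e s a) t (TCons e' s c).

(* The side conditions of R8 and R9 are expressed by the typing: the bound
   variable belongs to the context of t.  R1 and R2 are stated on the sequence
   of terms of a let, with the prefix provided by [steps_tail]. *)
Inductive step : forall G U B W, tm G U B W -> tm G U B W -> Prop :=
| R0 Th As V B W n_ge1 (vs : vals hom Th As) (t : tm As V B W) :
    step (Let n_ge1 (Seqs vs) t) (subst t vs)
| R3 Th Th' G D E A C B1 As U U' U'' V B W n_ge1
    (e1 : Th = G ++ E) (e2 : G = D ++ C) (e3 : Th = D ++ Th')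
    (e4 : Th' = C ++ E) (v : hom D A) (t : tm C U B1 U')
    (a : tms E U' As U'') (r : tm (B1 :: As) V B W) :
    step (Let n_ge1 (TCons e1 (PutL e2 v t) a) r)
         (PutL e3 v (Let n_ge1 (TCons e4 t a) r))
| R4 Th G E A B1 As U U' U'' V B W n_ge1
    (e1 : Th = G ++ E) (e2 : A :: Th = (A :: G) ++ E)
    (t : tm (A :: G) U B1 U')
    (a : tms E U' As U'') (r : tm (B1 :: As) V B W) :
    step (Let n_ge1 (TCons e1 (GetL t) a) r)
         (GetL (Let n_ge1 (TCons e2 t a) r))
| R5 Th Th' E G C D A B1 As U U' U'' V B W n_ge1
    (e1 : G = C ++ D) (e2 : Th = Th' ++ D) (v : hom D A)
    (a : tms E U As U') (t : tm C U' B1 U'')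
    (c : tms Th U (As ++ [:: B1]) ((A, white) :: U''))
    (c' : tms Th' U (As ++ [:: B1]) U'') (r : tm (As ++ [:: B1]) V B W) :
    trcons a (PutR e1 v t) c -> trcons a t c' ->
    step (Let n_ge1 c r) (PutR e2 v (Let n_ge1 c' r))
| R6 Th E G A B1 As U U' U'' V B W n_ge1
    (a : tms E U As U') (t : tm (G ++ [:: A]) U' B1 U'')
    (c : tms Th U (As ++ [:: B1]) ((A, black) :: U''))
    (c' : tms (Th ++ [:: A]) U (As ++ [:: B1]) U'')
    (r : tm (As ++ [:: B1]) V B W) :
    trcons a (GetR t) c -> trcons a t c' ->
    step (Let n_ge1 c r) (GetR (Let n_ge1 c' r))
| R7 Th G D C E F A A' U B W
    (e1 : Th = G ++ D) (e2 : G = C ++ E) (e3 : Th = C ++ F) (e4 : F = E ++ D)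
    (v : hom D A) (w : hom C A') (t : tm E U B W) :
    step (PutR e1 v (PutL e2 w t)) (PutL e3 w (PutR e4 v t))
| R8 Th G D A A' U B W
    (e1 : Th = G ++ D) (e2 : A' :: Th = (A' :: G) ++ D)
    (v : hom D A) (t : tm (A' :: G) U B W) :
    step (PutR e1 v (GetL t)) (GetL (PutR e2 v t))
| R9 Th D E A A' U B W
    (e1 : Th ++ [:: A'] = D ++ (E ++ [:: A'])) (e2 : Th = D ++ E)
    (v : hom D A) (t : tm (E ++ [:: A']) U B W) :
    step (GetR (PutL e1 v t)) (PutL e2 v (GetR t))
| R10 G A A' U B W (t : tm (A' :: (G ++ [:: A])) U B W) :
    step (GetR (GetL t)) (GetL (@GetR (A' :: G) A U B W t))
| step_let_seq G As U U' V B W n_ge1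
    (c c' : tms G U As U') (r : tm As V B W) :
    steps c c' -> step (Let n_ge1 c r) (Let n_ge1 c' r)
| step_let_body G As U U' V B W n_ge1
    (c : tms G U As U') (r r' : tm As V B W) :
    step r r' -> step (Let n_ge1 c r) (Let n_ge1 c r')
| step_putR Th D G A U B W (e : Th = D ++ G) (v : hom G A)
    (t t' : tm D U B W) :
    step t t' -> step (PutR e v t) (PutR e v t')
| step_getL G A U B W (t t' : tm (A :: G) U B W) :
    step t t' -> step (GetL t) (GetL t')
| step_getR G A U B W (t t' : tm (G ++ [:: A]) U B W) :
    step t t' -> step (GetR t) (GetR t')
| step_putL Th G D A U B W (e : Th = G ++ D) (v : hom G A)
    (t t' : tm D U B W) :
    step t t' -> step (PutL e v t) (PutL e v t')
with steps : forall G U As W, tms G U As W -> tms G U As W -> Prop :=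
| R1 Th F F' G C D E H A A1 A2 As U0 U1 U2 W
    (e1 : Th = G ++ F) (e2 : G = C ++ D) (e3 : F = E ++ H)
    (e4 : Th = C ++ F') (e5 : F' = (D ++ E) ++ H)
    (v : hom D A) (t : tm C U0 A1 U1) (s : tm (A :: E) U1 A2 U2)
    (b : tms H U2 As W) :
    steps (TCons e1 (PutR e2 v t) (TCons e3 (GetL s) b))
          (TCons e4 t (TCons e5 (substl v s) b))
| R2 Th F F' G C D E H A A1 A2 As U0 U1 U2 W
    (e1 : Th = C ++ F) (e2 : F = G ++ H) (e3 : G = D ++ E)
    (e4 : Th = (C ++ D) ++ F') (e5 : F' = E ++ H)
    (v : hom D A) (t : tm (C ++ [:: A]) U0 A1 U1) (s : tm E U1 A2 U2)
    (b : tms H U2 As W) :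
    steps (TCons e1 (GetR t) (TCons e2 (PutL e3 v s) b))
          (TCons e4 (substr v t) (TCons e5 s b))
| steps_head Th G D A As U V W (e : Th = G ++ D)
    (t t' : tm G U A V) (c : tms D V As W) :
    step t t' -> steps (TCons e t c) (TCons e t' c)
| steps_tail Th G D A As U V W (e : Th = G ++ D)
    (t : tm G U A V) (c c' : tms D V As W) :
    steps c c' -> steps (TCons e t c) (TCons e t c').

(* The set T(M) of terms, of any context and type. *)
Record term : Type := Term {
  term_ctx : ctx;
  term_left : word;
  term_cod : ob M;
  term_right : word;
  term_tm :> tm term_ctx term_left term_cod term_right }.

Inductive rewrites : term -> term -> Prop :=
| Rewrites G U B W (t t' : tm G U B W) :
    step t t' -> rewrites (Term t) (Term t').

End Terms.

(* Main.v *)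
(** Two weights are compared lexicographically, both invariant under value
    substitution.  The first counts symbols, but doubles the terms
    [t1 | ... | tn] of a let, so that R3-R6, which move a symbol out of them,
    decrease it, as do R0-R2, which erase symbols; R7-R10 preserve it.  The
    second instead doubles the argument of [putR] and [getR], so that R7-R10,
    which move a symbol out of it, decrease it. *)
Require Import Defs.
From mathcomp Require Import all_boot.
From mathcomp Require Import zify.

Set Implicit Arguments.
Unset Strict Implicit.
Unset Printing Implicit Defensive.

Scheme tm_tms_ind := Induction for tm Sort Prop
with tms_tm_ind := Induction for tms Sort Prop.
Combined Scheme tm_mutind from tm_tms_ind, tms_tm_ind.

Scheme step_steps_ind := Minimality for step Sort Prop
with steps_step_ind := Minimality for steps Sort Prop.
Combined Scheme step_mutind from step_steps_ind, steps_step_ind.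

Section Weight.
Variable M : multicategory.
Variables k l : nat.

(** [k] scales the sequence of a let, [l] the argument of [PutR] and [GetR]: [weight 2 1] is
    compared first, [weight 1 2] second. *)
Fixpoint weight G U B W (t : @tm M G U B W) : nat :=
  match t with
  | Seq _ _ _ => 1
  | Let _ _ _ _ _ _ _ _ ts s => k * weights ts + weight s
  | PutR _ _ _ _ _ _ _ _ _ s => l * weight s + 1
  | GetL _ _ _ _ _ s => weight s + 1
  | GetR _ _ _ _ _ s => l * weight s + 1
  | PutL _ _ _ _ _ _ _ _ _ s => weight s + 1
  end
with weights G U As W (ts : @tms M G U As W) : nat :=
  match ts with
  | TNil _ => 0
  | TCons _ _ _ _ _ _ _ _ _ t ts' => weight t + weights ts'
  end.

(** Substitution alters only values and contexts, which [weight] ignores. *)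
Lemma weight_subst_mut :
  (forall As U B W (t : @tm M As U B W) Th (vs : vals hom Th As),
     weight (subst t vs) = weight t) /\
  (forall Cs U As W (ts : @tms M Cs U As W) Th (vs : vals hom Th Cs),
     weights (substs ts vs) = weights ts).
Proof.
apply: tm_mutind => //=.
- by move=> G As U U' V B W n_ge1 ts IHts s _ Th vs; rewrite IHts.
- by move=> *; case: vsplit => * /=; congr (_ * _ + _).
- by move=> *; congr (_ + _).
- by move=> *; congr (_ * _ + _).
- by move=> *; case: vsplit => * /=; congr (_ + _).
(* [substs] transports [TNil] along an equation, whose proof is generalised before being
   eliminated. *)
- by move=> U Th vs; move: (esym _) => {vs} e; case: Th / e.
- by move=> *; case: vsplit => * /=; congr (_ + _).
Qed.

Lemma weight_subst As U B W (t : @tm M As U B W) Th (vs : vals hom Th As) :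
  weight (subst t vs) = weight t.
Proof. exact: weight_subst_mut.1. Qed.

(** Thus R0 lowers the weight by [k * size As], where [size As] is positive by the side condition of
    let. *)
Lemma weights_Seqs Th As (vs : vals (@hom M) Th As) :
  weights (Seqs vs) = size As.
Proof. by elim: vs => //= *; congr _.+1. Qed.

Lemma weights_trcons D G Th U As V A W
    (a : @tms M D U As V) (t : tm G V A W) (c : tms Th U (As ++ [:: A]) W) :
  trcons a t c -> weights c = weights a + weight t.
Proof.
elim=> [*|C E E' G' Th1 Th2 U' A0 As' V1 V2 A1 W' e e' s b u d _ /= ->] /=.
  by rewrite addn0.
by rewrite addnA.
Qed.

End Weight.

Definition lex_lt (m n m' n' : nat) : Prop := m < m' \/ m = m' /\ n < n'.

Lemma lex_lt_no_descent (f g : nat -> nat) :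
  ~ (forall i, lex_lt (f i.+1) (g i.+1) (f i) (g i)).
Proof.
move=> fg_desc.
suff no m : forall n i, f i < m -> g i < n -> False.
  exact: (no (f 0).+1 (g 0).+1 0).
elim: m => [|m IHm] //; elim=> [|n IHn] // i lt_f lt_g.
case: (fg_desc i) => [lt_f'|[eq_f lt_g']].
(* When [f] drops, [g] may have grown, so its bound is chosen afresh. *)
- by apply: (IHm (g i.+1).+1 i.+1) => //; lia.
- by apply: (IHn i.+1); lia.
Qed.

Section Decrease.
Variable M : multicategory.

(** Both weights are affine in each subterm with positive coefficients, so a lexicographic decrease
    of a subterm passes to the whole term. *)
Lemma step_weight_mut :
  (forall G U B W (t t' : @tm M G U B W), step t t' ->
     lex_lt (weight 2 1 t') (weight 1 2 t') (weight 2 1 t) (weight 1 2 t)) /\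
  (forall G U As W (c c' : @tms M G U As W), steps c c' ->
     lex_lt (weights 2 1 c') (weights 1 2 c')
            (weights 2 1 c) (weights 1 2 c)).
Proof.
apply: step_mutind; rewrite /lex_lt; move=> * /=;
  rewrite /substl /substr ?weight_subst ?weights_Seqs;
  (* In R5 and R6 the sequences before and after the step are known only through [trcons]. *)
  do ?[match goal with H : trcons _ _ _ |- _ =>
         rewrite !(weights_trcons _ _ H) /=; clear H end];
  lia.
Qed.

Lemma rewrites_weight (t t' : term M) : rewrites t t' ->
  lex_lt (weight 2 1 t') (weight 1 2 t') (weight 2 1 t) (weight 1 2 t).
Proof. by case=> G U B W s s' /(proj1 step_weight_mut). Qed.

End Decrease.

Theorem corollary3p12 (M : multicategory) :
  ~ exists t : nat -> term M, forall i : nat, rewrites (t i) (t i.+1).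
Proof.
case=> t t_steps.
apply: (@lex_lt_no_descent (fun i => weight 2 1 (t i))
                           (fun i => weight 1 2 (t i))) => i.
exact: rewrites_weight.
Qed.
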